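(* For all $n$ and all $p = p_n$ such that $p\binom{n}{2}$ is a non-negative integer and $n^{-2/3} < p_n < 1 - n^{-1/7}$, \[ f(n,p) \geq \frac{1}{4}(1-p)^{2/3} n^{2/3} - 1. \] Moreover, for each fixed real $c \geq 1$ and each fixed positive integer $r$, if $p = \frac{r}{r+1} + c n^{-2/3}$, then $f(n,p) = \Theta(n^{2/3})$; that is, there are constants $C_1, C_2 > 0$ and $n_0$ (depending only on $r$ and $c$) such that $C_1 n^{2/3} \leq f(n,p) \leq C_2 n^{2/3}$ for every $n \geq n_0$ for which $p\binom{n}{2}$, with this value of $p$, is an integer.
   Context: Graphs are finite and simple. The density of a graph $G$ on $n \geq 2$ vertices is $p = |E(G)|/\binom{n}{2}$. A full subgraph of a graph $G$ of density $p$ is an $m$-vertex subgraph $H$ of $G$ (with $m \geq 1$) of minimum degree at least $p(m-1)$. $f(G)$ denotes the largest number of vertices in a full subgraph of $G$. If $p\binom{n}{2}$ is a non-negative integer (and $0 \le p \le 1$), define \[ f(n,p) = \min\{ f(G) : |V(G)| = n,\ |E(G)| = p\tbinom{n}{2} \}. \] *)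

(* Defs.v *)
From HB Require Import structures.
From mathcomp Require Import all_boot all_order all_algebra.
From mathcomp Require Import all_classical all_reals all_analysis.

Set Implicit Arguments.
Unset Strict Implicit.
Unset Printing Implicit Defensive.

Import Order.TTheory GRing.Theory Num.Theory.
Local Open Scope ring_scope.

(* A simple graph on V is given by its edge set, a set of 2-element subsets. *)
Record sgraph (V : finType) := SGraph {
  edges : {set {set V}};
  _ : [forall e in edges, #|e| == 2%N] }.

HB.instance Definition _ (V : finType) := [isSub for @edges V].
HB.instance Definition _ (V : finType) := [Finite of sgraph V by <:].

Section Full.
Variables (R : realType) (V : finType).
Implicit Type G : sgraph V.

Definition density G : R := #|edges G|%:R / 'C(#|V|, 2)%:R.

(* Subgraphs need not be induced: H = (vertex set, edge set). *)
Definition is_subgraph G (H : {set V} * {set {set V}}) : bool :=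
  (H.2 \subset edges G) && [forall e in H.2, e \subset H.1].

Definition degree (H : {set V} * {set {set V}}) (x : V) : nat :=
  #|[set e in H.2 | x \in e]|.

Definition is_full G (H : {set V} * {set {set V}}) : bool :=
  [&& is_subgraph G H, H.1 != finset.set0 &
    [forall x in H.1, density G * (#|H.1|%:R - 1) <= (degree H x)%:R]].

Definition max_full G : nat := (\max_(H | is_full G H) #|H.1|)%N.

Lemma max_full_le G : (max_full G <= #|V|)%N.
Proof. by apply/bigmax_leqP => H _; exact: max_card. Qed.

(* The maximum is over a nonempty family: a single vertex is full. *)
Lemma max_full_attained G : (0 < #|V|)%N ->
  exists2 H, is_full G H & #|H.1| = max_full G.
Proof.
move=> /card_gt0P[x _].
have fullx : is_full G ([set x]%SET, finset.set0).
  apply/and3P; split => /=.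
  - rewrite /is_subgraph /= finset.sub0set /=.
    by apply/forallP => e; rewrite finset.in_set0.
  - by apply/set0Pn; exists x; rewrite finset.in_set1.
  - by apply/forallP => y; apply/implyP => _; rewrite cards1 subrr mulr0 ler0n.
pose size (H : {set V} * {set {set V}}) := #|H.1|.
case: (@arg_maxnP _ _ (is_full G) size fullx) => H fH Hmax.
exists H => //; apply/eqP; rewrite eqn_leq; apply/andP; split.
  exact: (leq_bigmax_cond (F := size)).
exact/bigmax_leqP.
Qed.

End Full.

(* f(n,p). The neutral element n of the minimum is harmless, since
   f(G) <= n for every G on n vertices; see f_np_attained. *)
Definition f_np (R : realType) (n : nat) (p : R) : nat :=
  \big[minn/n]_(G : sgraph 'I_n | #|edges G|%:R == p * 'C(n, 2)%:R)
    max_full R G.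

Lemma f_np_le (R : realType) (n : nat) (p : R) (G : sgraph 'I_n) :
  #|edges G|%:R = p * 'C(n, 2)%:R -> (f_np n p <= max_full R G)%N.
Proof.
move=> /eqP EG; rewrite /f_np; have := mem_index_enum G.
elim: (index_enum _) => // H s IH; rewrite inE big_cons.
case/predU1P => [<-|/IH le]; first by rewrite EG geq_minl.
by case: ifP => // _; exact: leq_trans (geq_minr _ _) le.
Qed.

Lemma f_np_attained (R : realType) (n : nat) (p : R) :
  0 <= p <= 1 -> p * 'C(n, 2)%:R \is a Num.nat ->
  exists2 G : sgraph 'I_n,
    #|edges G|%:R = p * 'C(n, 2)%:R & max_full R G = f_np n p.
Proof.
move=> /andP[p0 p1] /natrP[k pk].
have kle : (k <= 'C(n, 2))%N.
  by rewrite -(ler_nat R) -pk ler_piMl.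
have [G0 EG0] : exists G : sgraph 'I_n, #|edges G| = k.
  have : (k <= #|[set e : {set 'I_n} | #|e| == 2%N]%SET|)%N.
    by rewrite card_draws card_ord.
  case/card_geqP => s [us <- sA].
  have H : [forall e in [set e in s]%SET, #|e| == 2%N].
    by apply/forall_inP => e; rewrite inE => /sA; rewrite inE.
  by exists (SGraph H) => /=; rewrite cardsE; exact/card_uniqP.
pose P (G : sgraph 'I_n) := #|edges G|%:R == p * 'C(n, 2)%:R.
have PG0 : P G0 by rewrite /P EG0 pk.
case: (arg_minnP (@max_full R 'I_n) PG0) => G PG Gmin.
exists G; first exact/eqP.
apply/eqP; rewrite eqn_leq f_np_le ?andbT; last exact/eqP.
rewrite /f_np; elim/big_ind: _ => //.
- by apply: leq_trans (max_full_le _ _) _; rewrite card_ord.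
- by move=> a b Ha Hb; rewrite leq_min Ha Hb.
Qed.

(* Main.v *)
(* Lower bound. Write exc(S) for the number of edges inside S minus its expected value
   p C(|S|,2), and m for the largest order of a full subgraph. A set of maximal excess
   inside a given ground set is full, so it has at most m vertices, and every excess
   is at most (1-p) C(m,2). Split off K such sets one after another; let U be their
   union and Y the rest. By maximality every vertex of Y has at most the expected
   number of neighbours in U, and an edge inside Y loses at least K(1-p) on its two
   ends together. As exc(U), exc(Y) are at most (1-p) C(m,2) and the whole graph has
   excess 0, the total loss is at most (1-p) m(m-1), so all but few vertices of Y form
   an independent set. A large independent set I is impossible: adding one of its two
   halves to the complement of I gives a set of large excess. With K of order n/m this
   forces m^3 to be at least of order (1-p)^2 n^2. If p(m+1) <= 1 the argument is
   replaced by a direct one, since a set without isolated vertices is then full.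

   Upper bound. Take a balanced complete (r+1)-partite graph and put the surplus of
   order n^(4/3) edges inside a set K of order n^(2/3) vertices of one part. If a full
   set meets that part outside K, summing the degree conditions over the parts bounds
   its order by n^(2/3) + 1; otherwise the sum over the other parts bounds it by a
   multiple of |K|. *)
Require Import Defs.
From mathcomp Require Import all_boot all_order all_algebra.
From mathcomp Require Import all_classical all_reals all_analysis.
From mathcomp Require Import ring lra zify.

Set Implicit Arguments.
Unset Strict Implicit.
Unset Printing Implicit Defensive.

Import Order.TTheory GRing.Theory Num.Theory.
Local Open Scope ring_scope.

(** * Edges, degrees and the excess of a set *)

Lemma exists_subset_card (T : finType) (A : {set T}) k : (k <= #|A|)%N ->
  exists2 B : {set T}, B \subset A & #|B| = k.
Proof.
case/card_geqP=> [s [us ss sA]]; exists [set x in s]%SET.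
  by apply/fintype.subsetP => x; rewrite inE => /sA.
by rewrite cardsE -ss; apply/card_uniqP.
Qed.

Section Adjacency.
Variables (V : finType) (G : sgraph V).
Implicit Types (x y : V) (A S : {set V}).

Definition adj x y : bool := [set x; y]%SET \in edges G.

Lemma card_edge (e : {set V}) : e \in edges G -> #|e| = 2%N.
Proof. by case: G e => E /= /forall_inP E2 e /E2/eqP. Qed.

Lemma adjC x y : adj x y = adj y x.
Proof. by rewrite /adj finset.setUC. Qed.

Lemma adj_irr x : adj x x = false.
Proof.
by apply/negP => /card_edge; rewrite cards2 eqxx.
Qed.

Lemma adj_neq x y : adj x y -> x != y.
Proof. by apply: contraTneq => ->; rewrite adj_irr. Qed.

Lemma edge_at x (e : {set V}) :
  e \in edges G -> x \in e -> exists2 y, e = [set x; y]%SET & y \in e.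
Proof.
move=> /card_edge/eqP/cards2P[a [b [_ ->]]]; rewrite !inE.
case/orP=> /eqP->; first by exists b; rewrite // !inE eqxx orbT.
by exists a; [rewrite finset.setUC | rewrite !inE eqxx].
Qed.

Lemma set2_inj x : injective (fun y => [set x; y]%SET : {set V}).
Proof.
move=> y z /= eyz; have := finset.set22 x y; rewrite eyz !inE.
case/orP=> /eqP // yx; have := finset.set22 x z.
by rewrite -eyz yx !inE orbb => /eqP ->.
Qed.

Lemma card_edges_at S x : x \in S ->
  #|[set e in edges G | (e \subset S) && (x \in e)]%SET| =
  #|[set y in S | adj x y]%SET|.
Proof.
move=> xS; rewrite -(card_imset _ (@set2_inj x)); apply: eq_card => e.
rewrite !inE; apply/and3P/imsetP => [[eE eS xe]|[y]].
  have [y ey ye] := edge_at eE xe.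
  by exists y => //; rewrite inE (fintype.subsetP eS) //= /adj -ey.
rewrite inE => /andP[yS xy] ->; split => //; last by rewrite !inE eqxx.
by apply/fintype.subsetP => z; rewrite !inE => /orP[] /eqP ->.
Qed.

Lemma handshake : (\sum_x #|[set y | adj x y]%SET| = #|edges G| * 2)%N.
Proof.
have -> : (#|edges G| * 2 = \sum_(e in edges G) #|e|)%N.
  rewrite -sum_nat_const; apply: eq_bigr => e eE.
  by rewrite card_edge.
transitivity (\sum_x \sum_(e in edges G) (x \in e : nat))%N.
  apply: eq_bigr => x _.
  transitivity #|[set e in edges G | (e \subset [set: V]%SET) && (x \in e)]%SET|.
    by rewrite card_edges_at ?inE //; apply: eq_card => y; rewrite !inE.
  rewrite -sum1_card big_mkcond [RHS]big_mkcond.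
  apply: eq_bigr => e _.
  by rewrite !inE finset.subsetT; case: (e \in edges G); case: (x \in e).
rewrite exchange_big; apply: eq_bigr => e _.
by rewrite -sum1_card [RHS]big_mkcond; apply: eq_bigr => x _; case: (x \in e).
Qed.

Lemma degree_le H x : is_subgraph G H -> x \in H.1 ->
  (degree H x <= #|[set y in H.1 | adj x y]%SET|)%N.
Proof.
case/andP=> /fintype.subsetP HE /forall_inP HS xH.
rewrite -card_edges_at //; apply: subset_leq_card.
apply/fintype.subsetP => e; rewrite !inE => /andP[eH ->].
by rewrite HE // HS.
Qed.

Lemma card_edges_le_induced S :
  (forall x y, adj x y -> x \in S) -> (#|edges G| <= 'C(#|S|, 2))%N.
Proof.
move=> HS; rewrite -cards_draws; apply: subset_leq_card.
apply/fintype.subsetP => e eE; rewrite !inE (card_edge eE) eqxx andbT.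
apply/fintype.subsetP => x xe; have [y ey _] := edge_at eE xe.
by apply: (HS x y); rewrite /adj -ey.
Qed.

End Adjacency.

Lemma bin2_natr (R : realType) k : 2 * 'C(k, 2)%:R = k%:R * (k%:R - 1) :> R.
Proof.
case: k => [|k]; first by rewrite mulr0 mul0r.
by rewrite -natrM -mul_bin_diag bin1 natrM -[in RHS]natr1 addrK natr1.
Qed.

(** * Excess as a symmetric bilinear form on vertex sets *)

Section Excess.
Variables (R : realType) (V : finType) (G : sgraph V).
Implicit Types (x y : V) (A B C S U X Y I : {set V}).
Local Notation p := (density R G).
Local Notation q := (1 - p).
Local Notation m := (max_full R G).

(** The factor [x != y] makes the diagonal vanish, so pairing a set with itself needs no correction
    term. *)
Definition wt x y : R := (adj G x y)%:R - p * (x != y)%:R.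

(* Over [S] paired with itself this is 2 e(S) - p |S| (|S| - 1), twice the excess
   of the number of edges inside [S] over its expected value. *)
Definition exc A B : R := \sum_(x in A) \sum_(y in B) wt x y.

Lemma wtC x y : wt x y = wt y x.
Proof. by rewrite /wt adjC eq_sym. Qed.

Lemma wtxx x : wt x x = 0.
Proof. by rewrite /wt adj_irr eqxx mulr0 subr0. Qed.

Lemma excC A B : exc A B = exc B A.
Proof.
by rewrite /exc exchange_big; apply: eq_bigr => y _; apply: eq_bigr => x _;
   rewrite wtC.
Qed.

Lemma excUl A B C : [disjoint A & B] -> exc (A :|: B) C = exc A C + exc B C.
Proof.
move=> dAB; rewrite /exc.
under eq_bigl do rewrite !inE.
by rewrite bigU.
Qed.

Lemma excUU A B : [disjoint A & B] ->
  exc (A :|: B) (A :|: B) = exc A A + exc B B + 2 * exc A B.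
Proof.
move=> dAB; rewrite excUl // ![exc _ (A :|: B)]excC !excUl // (excC B A).
by ring.
Qed.

Lemma exc1 x B : exc [set x]%SET B = \sum_(y in B) wt x y.
Proof. by rewrite /exc big_set1. Qed.

Lemma exc11 x : exc [set x]%SET [set x]%SET = 0.
Proof. by rewrite exc1 big_set1 wtxx. Qed.

Lemma exc_sum A B : exc A B = \sum_(x in A) exc [set x]%SET B.
Proof. by apply: eq_bigr => x _; rewrite exc1. Qed.

Lemma exc0l B : exc finset.set0 B = 0.
Proof. by rewrite /exc big_set0. Qed.

Lemma sum_neq x S : x \in S -> \sum_(y in S) (x != y)%:R = #|S|%:R - 1 :> R.
Proof.
move=> xS; rewrite (bigD1 x) //= eqxx add0r.
rewrite (eq_bigr (fun=> 1)); last by move=> y /andP[_ /negPf]; rewrite eq_sym => ->.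
by rewrite -[in RHS]sum1_card natr_sum [in RHS](bigD1 x) //= [RHS]addrC addKr.
Qed.

Lemma sum_adj x S :
  \sum_(y in S) (adj G x y)%:R = #|[set y in S | adj G x y]%SET|%:R :> R.
Proof.
rewrite -sum1_card natr_sum big_mkcond [RHS]big_mkcond.
by apply: eq_bigr => y _; rewrite !inE; case: (y \in S); case: adj.
Qed.

(** Links excess to fullness: the degree condition at [x] in the subgraph induced on [S] says that
    this quantity is non-negative. *)
Lemma exc_deg x S : x \in S ->
  exc [set x]%SET S = #|[set y in S | adj G x y]%SET|%:R - p * (#|S|%:R - 1).
Proof.
move=> xS; rewrite exc1 /wt sumrB sum_adj -mulr_sumr sum_neq //.
Qed.

Lemma density_ge0 : 0 <= p.
Proof. by rewrite /density divr_ge0 ?ler0n. Qed.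

Lemma density_le1 : p <= 1.
Proof.
rewrite /density; have [V1|V2] := leqP #|V| 1.
  by rewrite bin_small // invr0 mulr0.
rewrite ler_pdivrMr ?ltr0n ?bin_gt0 // mul1r ler_nat -cardsT.
by apply: card_edges_le_induced => x y _; rewrite inE.
Qed.

Lemma exc_ge S : - (p * (#|S|%:R * (#|S|%:R - 1))) <= exc S S.
Proof.
have -> : - (p * (#|S|%:R * (#|S|%:R - 1))) = \sum_(x in S) - (p * (#|S|%:R - 1)).
  by rewrite sumr_const -[in RHS]mulr_natl; ring.
rewrite exc_sum; apply: ler_sum => x xS.
by rewrite exc_deg // lerDr ler0n.
Qed.

Lemma exc_indep I : {in I &, forall x y, ~~ adj G x y} ->
  exc I I = - (p * (#|I|%:R * (#|I|%:R - 1))).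
Proof.
move=> HI.
have -> : - (p * (#|I|%:R * (#|I|%:R - 1))) = \sum_(x in I) - (p * (#|I|%:R - 1)).
  by rewrite sumr_const -[in RHS]mulr_natl; ring.
rewrite exc_sum; apply: eq_bigr => x xI.
rewrite exc_deg // (_ : [set y in I | adj G x y]%SET = finset.set0) ?cards0 ?add0r //.
by apply/setP => y; rewrite !inE; apply/negbTE/negP => /andP[yI]; apply/negP/HI.
Qed.

Lemma exc_le S : exc S S <= q * (#|S|%:R * (#|S|%:R - 1)).
Proof.
have -> : q * (#|S|%:R * (#|S|%:R - 1)) = \sum_(x in S) (q * (#|S|%:R - 1)).
  by rewrite sumr_const -[in RHS]mulr_natl; ring.
rewrite exc_sum; apply: ler_sum => x xS.
rewrite exc_deg //.
suff : #|[set y in S | adj G x y]%SET|%:R <= #|S|%:R - 1 :> R by lra.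
rewrite -(sum_neq xS) -sum_adj; apply: ler_sum => y yS.
by rewrite ler_nat; case: (adj G x y) (@adj_neq _ G x y) => // ->.
Qed.

Lemma excT : exc finset.setT finset.setT = 0.
Proof.
(* With at most one vertex the density divides by 0 and is 0 by convention; the general bounds then
   squeeze the excess to 0. *)
have [V1|V2] := leqP #|V| 1.
  have V01 : #|V|%:R * (#|V|%:R - 1) = 0 :> R.
    by case: #|V| V1 => [|[]] // _; rewrite ?mul0r ?subrr ?mulr0.
  have := exc_ge finset.setT; have := exc_le finset.setT.
  by rewrite !cardsT V01 !mulr0 oppr0 => a b; apply/eqP; rewrite eq_le a b.
rewrite exc_sum (eq_bigl xpredT) => [|x]; last by rewrite inE.
rewrite (eq_bigr (fun x => #|[set y | adj G x y]%SET|%:R - p * (#|V|%:R - 1))).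
  rewrite sumrB -natr_sum handshake sumr_const natrM.
  have C0 : ('C(#|V|, 2)%:R : R) != 0 by rewrite pnatr_eq0 -lt0n bin_gt0.
  have := bin2_natr R #|V|.
  rewrite /density => C2; rewrite -[X in _ - X]mulr_natl mulrCA -C2.
  by field.
move=> x _; rewrite exc_deg ?finset.in_setT // cardsT.
by congr (_%:R - _); apply: eq_card => y; rewrite !inE.
Qed.


(** * Sets of maximal excess and their fullness *)

Lemma full_le S : S != finset.set0 ->
  {in S, forall x, p * (#|S|%:R - 1) <= #|[set y in S | adj G x y]%SET|%:R} ->
  (#|S| <= m)%N.
Proof.
move=> S0 HS.
apply: (@leq_bigmax_cond _ (is_full R G) (fun H => #|H.1|)
  (S, [set e in edges G | e \subset S]%SET)).
apply/and3P; split => //=.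
  apply/andP; split; first by apply/fintype.subsetP => e; rewrite inE => /andP[].
  by apply/forall_inP => e; rewrite inE => /andP[].
apply/forall_inP => x xS; rewrite (le_trans (HS x xS)) // ler_nat.
rewrite -card_edges_at //; apply: subset_leq_card.
by apply/fintype.subsetP => e; rewrite !inE andbA.
Qed.

(** Deleting [x] from [X] lowers [exc X X] by twice [exc [set x] X]. By maximality this is
    non-negative for every [x] in [X], so [X] induces a full subgraph. *)
Lemma exc_max_card X :
  (forall Y : {set V}, Y \subset X -> exc Y Y <= exc X X) -> (#|X| <= m)%N.
Proof.
move=> maxX; have [->|X0] := eqVneq X finset.set0; first by rewrite cards0.
apply: full_le => // x xX; rewrite -subr_ge0 -exc_deg //.
have := maxX _ (subsetDl X [set x]%SET).
have dis : [disjoint [set x]%SET & X :\ x] by rewrite disjoints1 !inE eqxx.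
rewrite -{3 4 5}(finset.setD1K xX) excUU // exc11 add0r.
rewrite [exc [set x]%SET (_ :|: _)]excC excUl // excC exc11 excC.
by lra.
Qed.

Lemma exc_max_exists Y : exists2 X : {set V}, X \subset Y &
  forall Z : {set V}, Z \subset Y -> exc Z Z <= exc X X.
Proof.
case: (@Order.TotalTheory.arg_maxP _ _ _ finset.set0 (fun Z : {set V} => Z \subset Y)
  (fun Z => exc Z Z)) => [|X XY maxX]; first exact: finset.sub0set.
by exists X.
Qed.

Lemma exc_bound S : exc S S <= q * (m%:R * (m%:R - 1)).
Proof.
have [X _ maxX] := exc_max_exists finset.setT.
apply: le_trans (maxX _ (finset.subsetT S)) _.
apply: le_trans (exc_le X) _.
have Xm : (#|X| <= m)%N by apply: exc_max_card => Y _; apply/maxX/finset.subsetT.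
have q0 : 0 <= q by rewrite subr_ge0 density_le1.
apply: ler_wpM2l => //.
(* For empty [X] the factor [#|X| - 1] is negative, so the monotonicity argument for products is
   reserved for nonempty [X]. *)
have [->|X0] := posnP #|X|.
  rewrite mul0r; case: (max_full _ _) => [|k]; first by rewrite mul0r.
  by rewrite mulr_ge0 // subr_ge0 ler1n.
by apply: ler_pM => //; rewrite ?subr_ge0 ?ler1n // ?lerD2r ler_nat.
Qed.

(* Repeatedly splitting off a set [X] of maximal excess: a vertex outside [X] has at
   most the expected number of neighbours in [X], and an edge [xy] outside [X] loses
   [1 - p] on top of that because adding both ends must not increase the excess. *)
Lemma split_off (k : nat) : exists U : {set V}, [/\ (#|U| <= k * m)%N,
  forall x, x \notin U -> exc [set x]%SET U <= 0 &
  forall x y, x \notin U -> y \notin U -> adj G x y ->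
    exc [set x]%SET U + exc [set y]%SET U <= - (k%:R * q)].
Proof.
elim: k => [|k [U [cU U0 U1]]].
  exists finset.set0; split=> [|x _|x y _ _ _]; first by rewrite cards0.
    by rewrite excC exc0l.
  by rewrite excC exc0l excC exc0l mul0r oppr0 addr0.
have [X XU maxX] := exc_max_exists (~: U).
have dUX : [disjoint U & X] by rewrite disjoint_sym -(finset.setCK U) -finset.subsets_disjoint.
have cX : (#|X| <= m)%N.
  by apply: exc_max_card => Y YX; apply/maxX/fintype.subset_trans/XU.
exists (U :|: X); split.
- by rewrite (leq_trans (leq_card_setU _ _)) // mulSn addnC leq_add.
- move=> x; rewrite !inE negb_or => /andP[xU xX].
  rewrite excC excUl // excC [exc X _]excC.
  have := maxX (x |: X); rewrite finset.subUset finset.sub1set inE xU => /(_ XU).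
  rewrite excUU ?disjoints1 // exc11 add0r => ?.
  by have := U0 x xU; lra.
- move=> x y; rewrite !inE !negb_or => /andP[xU xX] /andP[yU yX] xy.
  rewrite excC excUl // [exc [set y]%SET _]excC excUl //.
  rewrite ![exc _ [set x]%SET]excC ![exc _ [set y]%SET]excC.
  have xyN := adj_neq xy.
  have := maxX (x |: (y |: X)); rewrite !finset.subUset !finset.sub1set !inE xU yU.
  move=> /(_ XU); rewrite excUU; last by rewrite disjoints1 !inE negb_or xyN.
  rewrite excUU ?disjoints1 // !exc11 [exc _ (_ |: _)]excC excUl ?disjoints1 //.
  rewrite [exc [set y]%SET [set x]%SET]exc1 big_set1 wtC /wt xy xyN [exc X [set x]%SET]excC /= mulr1 => ?.
  by have := U1 x y xU yU xy; rewrite -[k.+1%:R]natr1; lra.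
Qed.

End Excess.

(** * The lower bound *)

(** If [i >= 5n/8], the bracket [E] is at least its value at [i = 5n/8], about [7n^2/128]. As
    [d (m + 1) > 1], multiplying the last hypothesis by [m + 1] gives
    [E < 2 m (m - 1) (m + 1) <= n^2/32], a contradiction. *)
Lemma dense_indep_numeric (R : realFieldType) (d n i m : R) :
  0 < n -> 1 <= m -> 0 < 1 - d -> 0 <= d -> 1 < d * (m + 1) -> i <= n ->
  64 * (m + 1) ^+ 3 < n ^+ 2 ->
  d * ((i ^+ 2 - 1) / 2 - (n - i) * (n - i - 1)) <= 2 * ((1 - d) * (m * (m - 1))) ->
  8 * i < 5 * n.
Proof.
move=> n0 m1 q0 d0 dm iN mn; apply: contraTT; rewrite -leNgt -ltNge => i5.
set E := _ - _ * _.
have m3 : 512 <= 64 * (m + 1) ^+ 3 by nra.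
have n1 : 1 <= n by rewrite -(ler_pXn2r (ltn0Sn 1)) ?nnegrE ?expr1n; lra.
have h : 0 <= (8 * i - 5 * n) * (22 * n - (8 * i - 5 * n) - 16).
  by rewrite mulr_ge0 //; lra.
have E7 : 7 / 128 * n ^+ 2 + 3 / 8 * n - 1 / 2 <= E by rewrite /E; nra.
have mmm : m * (m - 1) * (m + 1) <= n ^+ 2 / 64 by nra.
have n2 : 16 <= n ^+ 2 by lra.
have mm : 0 <= m * (m - 1) by nra.
rewrite -(ltr_pM2r (x := m + 1)); last by lra.
have E0 : 0 < E by nra.
have : E < d * E * (m + 1) by rewrite mulrAC ltr_pMl.
have : (1 - d) * (m * (m - 1) * (m + 1)) <= m * (m - 1) * (m + 1).
  by rewrite ler_piMl //; [rewrite mulr_ge0 //; lra | lra].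
nra.
Qed.

Lemma dense_numeric (R : realFieldType) (n s k m : R) :
  0 < n -> 1 <= m -> 3 * n <= 16 * s -> 3 * n <= 16 * (k * m + m) ->
  0 <= k ->
  s * k <= 2 * (m * (m - 1)) -> n ^+ 2 <= 64 * (m + 1) ^+ 3.
Proof.
move=> n0 m1 ns nk k0 sk; rewrite leNgt; apply/negP => mn.
have h1 : s * k * m <= 2 * (m * (m - 1)) * m by rewrite ler_pM2r //; lra.
have km : 0 <= k * m by rewrite mulr_ge0 //; lra.
have h2 : 3 * n * (k * m) <= 16 * s * (k * m) by rewrite ler_wpM2r.
have h3 : 3 * n * (3 * n) <= 3 * n * (16 * (k * m + m)) by rewrite ler_pM2l //; lra.
(* AM-GM for the cross term: [48 n m <= n^2 + 576 m^2]. *)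
have h4 : 0 <= (n - 24 * m) ^+ 2 by rewrite sqr_ge0.
have h5 : 0 <= m ^+ 2 by rewrite sqr_ge0.
nra.
Qed.

(** * Order of a largest full subgraph, bounded in terms of [p] and [#|V|] *)

Section LowerBound.
Variables (R : realType) (V : finType) (G : sgraph V).
Implicit Types (x y : V) (A B C S U X Y I : {set V}).
Local Notation p := (density R G).
Local Notation q := (1 - p).
Local Notation m := (max_full R G).
Local Notation exc := (exc R G).

(* Splitting [I] into two halves, the two sets obtained by adding a half to the
   complement of [I] cannot both have small excess. *)
Lemma indep_small I : {in I &, forall x y, ~~ adj G x y} ->
  p * ((#|I|%:R ^+ 2 - 1) / 2 - (#|V|%:R - #|I|%:R) * (#|V|%:R - #|I|%:R - 1))
  <= 2 * (q * (m%:R * (m%:R - 1))).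
Proof.
move=> HI.
have [A AI cA] : exists2 A : {set V}, A \subset I & #|A| = #|I|./2.
  by apply: exists_subset_card; lia.
pose B := I :\: A; pose J := ~: I.
have IE : I = A :|: B by rewrite -{1}(finset.setID I A) (finset.setIidPr AI).
have dAB : [disjoint A & B].
  by rewrite -finset.setI_eq0; apply/eqP/setP => x; rewrite !inE; case: (x \in A).
have dJI : [disjoint J & I].
  by rewrite -finset.setI_eq0 finset.setIC finset.setICr.
have dJA : [disjoint J & A] := disjointWr AI dJI.
have dJB : [disjoint J & B] by apply: disjointWr dJI; apply: finset.subsetDl.
have cB : (#|I| = #|A| + #|B|)%N by rewrite {1}IE cardsU disjoint_setI0 // cards0 subn0.
have cJ : (#|V| = #|I| + #|J|)%N by rewrite cardsC.
have eT : exc J J + exc I I + 2 * exc J I = 0.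
  by rewrite -excUU // finset.setUC finset.setUCr excT.
have eJI : exc J I = exc J A + exc J B.
  by rewrite {1}IE excC excUl // (excC R G A) (excC R G B).
have indep (D : {set V}) : D \subset I -> exc D D = - (p * (#|D|%:R * (#|D|%:R - 1))).
  by move/fintype.subsetP=> DI; apply: exc_indep => x y /DI xI /DI; apply: HI.
(* The two bounds are added and [exc J I] is eliminated through the zero total excess. What remains
   is [exc J J + 2 p |A| |B| <= 2 q m (m - 1)]. *)
have := exc_bound R G (J :|: A); have := exc_bound R G (J :|: B).
rewrite !excUU // (indep A) // (indep B); last exact: finset.subsetDl.
have -> : #|V|%:R - #|I|%:R = #|J|%:R :> R by rewrite cJ natrD addrAC subrr add0r.
move: eT; rewrite eJI (indep I) // cB natrD.
have := exc_ge R G J.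
(* The halves differ in size by at most 1; this parity loss is the [- 1] in the statement. *)
have : (#|A|%:R + #|B|%:R) ^+ 2 - 1 <= 4 * (#|A|%:R * #|B|%:R) :> R.
  have : (#|B| = #|A| \/ #|B| = #|A|.+1)%N by rewrite cA; move: cB; rewrite cA; lia.
  by case=> ->; rewrite -?natr1; nra.
move=> /(ler_wpM2l (density_ge0 R G)).
move: (exc _ _) (exc _ A) (exc _ B) => a b c; move: (#|J|%:R) (#|A|%:R) (#|B|%:R) => j x y.
by lra.
Qed.

(** A largest set [S] of at most [m + 2] vertices without isolated vertices has at most [m]:
    otherwise its degrees, at least [1 >= p (m + 1)], make it full. Then the ends of any edge can be
    added within the size limit, so [S] already contains every edge. *)
Lemma edges_le_of_sparse : p * m.+1%:R <= 1 -> (#|edges G| <= 'C(m, 2))%N.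
Proof.
move=> pm.
pose good S := [forall x in S, [set y in S | adj G x y]%SET != finset.set0] &&
               (#|S| <= m.+2)%N.
have g0 : good finset.set0.
  by rewrite /good cards0 andbT; apply/forall_inP => x; rewrite inE.
have [S /andP[/forall_inP Sdeg Sm] maxS] := arg_maxnP (fun S => #|S|) g0.
have [Sm1|mS] := leqP #|S| m; last first.
  suff : (#|S| <= m)%N by rewrite leqNgt mS.
  apply: full_le => [|x /Sdeg].
    by rewrite -card_gt0 (leq_ltn_trans _ mS).
  rewrite -card_gt0 -(ler_nat R) => /(le_trans _); apply; apply: le_trans pm.
  apply: ler_wpM2l; first exact: density_ge0.
  by rewrite lerBlDr natr1 ler_nat.
apply: leq_trans (leq_bin2l 2 Sm1).
apply: card_edges_le_induced => x y xy; apply/contraT => xS.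
have /maxS : good (S :|: [set x; y]%SET).
  apply/andP; split.
    apply/forall_inP => z; rewrite !inE => /orP[/Sdeg/set0Pn[t]|/orP[]/eqP->].
    - by rewrite inE => /andP[tS zt]; apply/set0Pn; exists t; rewrite !inE tS.
    - by apply/set0Pn; exists y; rewrite !inE eqxx !orbT.
    - by apply/set0Pn; exists x; rewrite !inE eqxx !orbT adjC.
  rewrite (leq_trans (leq_card_setU _ _)) // cards2 (adj_neq xy) addn2 !ltnS.
  exact: Sm1.
rewrite /= leqNgt; case/negP; apply: proper_card.
rewrite properUl //; apply/negP => /fintype.subsetP/(_ x); rewrite !inE eqxx.
by move/(_ isT); apply/negP.
Qed.

Lemma max_full_gt0 : (0 < #|V|)%N -> (0 < m)%N.
Proof.
by move=> /(max_full_attained R G)[H /and3P[_ H0 _] <-]; rewrite card_gt0.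
Qed.

Lemma dense_bound : (0 < #|V|)%N -> 0 < q -> 1 < p * m.+1%:R ->
  #|V|%:R ^+ 2 <= 64 * m.+1%:R ^+ 3 :> R.
Proof.
move=> V0 q0 pm; rewrite leNgt; apply/negP => mn.
have m0 := max_full_gt0 V0.
(* This [K] keeps [#|U|] below [3n/16]. With [#|I| < 5n/8] at least [3n/16] vertices are left for
   [S]. *)
pose K := (3 * #|V| %/ (16 * m))%N.
have [U [cU U0 U1]] := split_off R G K.
(* [S] collects the vertices bearing at least half the loss of an edge; two adjacent vertices
   outside [U] cannot both miss it, so [I] is independent. *)
pose S := [set x in ~: U | exc [set x]%SET U <= - (K%:R * q / 2)]%SET.
pose I := ~: (U :|: S).
have HI : {in I &, forall x y, ~~ adj G x y}.
  move=> x y; rewrite !inE !negb_or !negb_and => /andP[xU xS] /andP[yU yS].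
  move: xS yS; rewrite xU yU -!ltNge => xS yS.
  by apply/negP => /(U1 x y xU yU); lra.
have dUS : [disjoint U & S].
  rewrite -finset.setI_eq0; apply/eqP/setP => x; rewrite !inE.
  by case: (x \in U).
have cI : (#|V| = #|U| + #|S| + #|I|)%N.
  by rewrite -(cardsC (U :|: S)) cardsU disjoint_setI0 // cards0 subn0.
(* Zero total excess gives [exc (~: U) U >= - q m (m - 1)], while each vertex of [S] contributes at
   most [- K q / 2] and the others at most 0. The factor [q] cancels. *)
have SK : #|S|%:R * K%:R <= 2 * (m%:R * (m%:R - 1)) :> R.
  rewrite -(ler_pM2r q0).
  have dUY : [disjoint U & ~: U] by rewrite -finset.setI_eq0 finset.setICr.
  have := excT R G; rewrite -(finset.setUCr U) excUU // excC.
  have := exc_bound R G U; have := exc_bound R G (~: U).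
  suff : exc (~: U) U <= - (#|S|%:R * (K%:R * q / 2)) by lra.
  rewrite exc_sum (bigID (mem S)) /=.
  rewrite -[X in _ <= X]addr0 lerD //; last first.
    by apply: sumr_le0 => x /andP[]; rewrite inE => /U0.
  rewrite mulr_natl -mulNrn -sumr_const big_mkcond [X in _ <= X]big_mkcond.
  by apply: ler_sum => x _; rewrite !inE; case: (x \in U) => //=; case: ifP.
have := indep_small HI.
have nE : #|V|%:R = #|U|%:R + #|S|%:R + #|I|%:R :> R by rewrite cI !natrD.
have UKm : #|U|%:R <= K%:R * m%:R :> R by rewrite -natrM ler_nat.
have K1 : 16 * (K%:R * m%:R) <= 3 * #|V|%:R :> R.
  rewrite -!natrM ler_nat /K; have := leq_trunc_div (3 * #|V|) (16 * m); lia.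
have K2 : 3 * #|V|%:R <= 16 * (K%:R * m%:R + m%:R) :> R.
  rewrite -!natrM -natrD -!natrM ler_nat /K.
  have : (0 < 16 * m)%N by rewrite muln_gt0.
  by move=> /(ltn_ceil (3 * #|V|)); lia.
have m1 : 1 <= m%:R :> R by rewrite ler1n.
have n0 : 0 < #|V|%:R :> R by rewrite ltr0n.
have IV : #|I|%:R <= #|V|%:R :> R by rewrite ler_nat max_card.
move: (pm) mn; rewrite -[m.+1%:R]natr1 => pm1 mn HE.
have i5 := dense_indep_numeric n0 m1 q0 (density_ge0 R G) pm1 IV mn HE.
have s3 : 3 * #|V|%:R <= 16 * #|S|%:R :> R by lra.
have := dense_numeric n0 m1 s3 K2 (ler0n R K) SK.
by rewrite leNgt mn.
Qed.

(** Since [q <= 1], it suffices to bound [n^2]. If [p (m + 1) > 1] this is [dense_bound]; otherwise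
    all edges fit into [m] vertices, which is too few for [p^3 n^2 > 1]. *)
Lemma max_full_lower : (2 <= #|V|)%N -> 0 < q -> 1 < p ^+ 3 * #|V|%:R ^+ 2 ->
  q ^+ 2 * #|V|%:R ^+ 2 <= 64 * m.+1%:R ^+ 3 :> R.
Proof.
move=> V2 q0 pn.
have q1 : q <= 1 by rewrite gerBl density_ge0.
have qn : q ^+ 2 * #|V|%:R ^+ 2 <= #|V|%:R ^+ 2 :> R.
  by rewrite ler_piMl ?sqr_ge0 // expr_le1 // ltW.
have [/edges_le_of_sparse Em|pm] := leP (p * m.+1%:R) 1; last first.
  by apply: le_trans qn _; apply: dense_bound => //; apply: ltn_trans V2.
apply: le_trans qn _; rewrite leNgt; apply/negP => mn.
have m0 : (0 < m)%N by apply: max_full_gt0; apply: ltn_trans V2.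
have pE : p * (#|V|%:R * (#|V|%:R - 1)) <= m%:R * (m%:R - 1).
  rewrite -!bin2_natr.
  rewrite mulrCA /density divfK ?pnatr_eq0 -?lt0n ?bin_gt0 //.
  by rewrite ler_pM2l // ler_nat.
move: mn pE pn (density_ge0 R G); rewrite -[m.+1%:R]natr1.
have : 1 <= m%:R :> R by rewrite ler1n.
have : 2 <= #|V|%:R :> R by rewrite ler_nat.
move: (density R G) (#|V|%:R) (m%:R) => d n M n2 M1 mn pE pn d0.
(* Cubing [d n^2 <= 2 M^2] and using [d^3 n^2 > 1] yields [n^4 < 8 M^6], against [64 M^3 <= n^2]. *)
have h1 : d * (n * n) <= 2 * M ^+ 2.
  apply: (@le_trans _ _ (2 * (d * (n * (n - 1))))); last by nra.
  by rewrite [X in _ <= X]mulrCA ler_wpM2l //; nra.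
have h2 : (d * (n * n)) ^+ 3 <= (2 * M ^+ 2) ^+ 3.
  by rewrite lerXn2r ?nnegrE // mulr_ge0 //; nra.
have h3 : n ^+ 4 < (d * (n * n)) ^+ 3.
  have -> : (d * (n * n)) ^+ 3 = d ^+ 3 * n ^+ 2 * n ^+ 4 by ring.
  by rewrite ltr_pMl // exprn_gt0 //; lra.
have h4 : 64 * M ^+ 3 <= n ^+ 2 by nra.
have h5 : (64 * M ^+ 3) ^+ 2 <= (n ^+ 2) ^+ 2.
  by rewrite lerXn2r ?nnegrE //; nra.
have h6 : 0 < (M ^+ 3) ^+ 2 by rewrite exprn_gt0 // exprn_gt0 //; lra.
have h7 : (2 * M ^+ 2) ^+ 3 = 8 * (M ^+ 3) ^+ 2 by ring.
have h8 : (n ^+ 2) ^+ 2 = n ^+ 4 by ring.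
nra.
Qed.

End LowerBound.

(** * Return to real exponents: the lower bound for [f_np] *)

Lemma powR_3rd (R : realType) (x : R) (k : nat) : 0 <= x ->
  (x `^ (k%:R / 3)) ^+ 3 = x ^+ k.
Proof.
move=> x0; rewrite -powR_mulrn ?powR_ge0 // -powRrM.
by rewrite divfK ?pnatr_eq0 // powR_mulrn.
Qed.

Lemma f_np_lower (R : realType) (n : nat) (p : R) :
  (2 <= n)%N -> p * 'C(n, 2)%:R \is a Num.nat ->
  n%:R `^ (- (2 / 3)) < p < 1 ->
  1 / 4 * (1 - p) `^ (2 / 3) * n%:R `^ (2 / 3) - 1 <= (f_np n p)%:R.
Proof.
move=> n2 pC /andP[np p1].
have p0 : 0 < p by apply: le_lt_trans np; apply: powR_ge0.
have n0 : 0 < n%:R :> R by rewrite ltr0n; apply: ltn_trans n2.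
have [|G EG <-] := f_np_attained _ pC; first by rewrite !ltW.
have dG : density R G = p.
  by rewrite /density EG card_ord mulfK // pnatr_eq0 -lt0n bin_gt0.
have := max_full_lower (R := R) (G := G); rewrite dG card_ord => /(_ n2).
rewrite subr_gt0 => /(_ p1) lower.
(* The term [- 1] moves across to form [m + 1], and both sides are cubed; [(1/4)^3] matches the
   constant 64. *)
rewrite lerBlDr natr1 -(ler_pXn2r (ltn0Sn 2)) ?nnegrE ?mulr_ge0 ?powR_ge0 //.
rewrite !exprMn !(powR_3rd 2) ?subr_ge0 ?(ltW p1) //.
suff /lower : 1 < p ^+ 3 * n%:R ^+ 2 by lra.
have : (n%:R `^ (- (2 / 3))) ^+ 3 < p ^+ 3.
  by rewrite ltrXn2r // powR_ge0.
rewrite powRN exprVn (powR_3rd 2) ?ltW // => h.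
by rewrite -ltr_pdivrMr ?exprn_gt0 // div1r.
Qed.

(** * The upper bound *)

Section MultipartiteBound.
Variables (R : realType) (V : finType) (G : sgraph V) (r : nat).
Variables (col : V -> 'I_r.+1) (K : {set V}) (delta : R).
Hypothesis colG : forall x y, adj G x y -> col x = col y -> x \in K /\ col x = ord0.
Hypothesis densG : density R G = r%:R / r.+1%:R + delta.
Hypothesis delta_ge0 : 0 <= delta.

(** A vertex of [H] outside [K] or of nonzero colour [a] has no neighbour in its class, so
    [p (M - 1) <= M - |part a|]. If class 0 also satisfies this, summing over all classes leaves the
    first alternative. Otherwise [part ord0] lies in [K], and the sum over the other [r] classes
    gives the second. *)
Lemma multipartite_full H : is_full R G H ->
  r.+1%:R * delta * (#|H.1|%:R - 1) <= r%:R \/ (#|H.1| <= r.+1 * (#|K| + r))%N.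
Proof.
case/and3P=> HG H0 /forall_inP Hfull.
pose part (a : 'I_r.+1) := [set x in H.1 | col x == a]%SET.
have sum_part : (#|H.1| = \sum_a #|part a|)%N.
  rewrite -sum1_card (partition_big col xpredT) //=; apply: eq_bigr => a _.
  by rewrite -sum1_card; apply: eq_bigl => x; rewrite inE.
set M : R := #|H.1|%:R.
have M1 : 1 <= M by rewrite ler1n card_gt0.
have deg x : x \in H.1 -> (col x != ord0) || (x \notin K) ->
    density R G * (M - 1) <= M - #|part (col x)|%:R.
  move=> xH xK; apply: le_trans (Hfull x xH) _.
  rewrite lerBrDr -natrD ler_nat.
  apply: leq_trans (leq_add (degree_le HG xH) (leqnn _)) _.
  rewrite -cardsUI [X in (_ + X)%N](_ : _ = 0)%N ?addn0.
    by apply: subset_leq_card; apply/fintype.subsetP => y;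
      rewrite !inE => /orP[] /andP[].
  apply/eqP; rewrite cards_eq0; apply/eqP/setP => y; rewrite !inE.
  apply/negbTE/negP => /andP[/andP[_ xy] /andP[_ /eqP yx]].
  by have [xK' x0] := colG xy (esym yx); move: xK; rewrite xK' x0 eqxx.
(* An empty class offers no vertex to test, but there the inequality follows from [p <= 1]. *)
have deg0 a : #|part a| = 0%N -> density R G * (M - 1) <= M - #|part a|%:R.
  move=> ->; rewrite subr0; apply: (@le_trans _ _ (M - 1)); last by lra.
  by apply: ler_piMl; [lra | exact: density_le1].
have deg_lift a : a != ord0 -> density R G * (M - 1) <= M - #|part a|%:R.
  move=> a0; have [/deg0 //|] := posnP #|part a|.
  move=> /card_gt0P[x]; rewrite inE => /andP[xH /eqP xa].
  by rewrite -xa; apply: deg => //; rewrite xa a0.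
have [/fintype.subsetP partK|/subsetPn[x]] := boolP (part ord0 \subset K).
  right; have x0 : #|part ord0|%:R <= #|K|%:R :> R.
    by rewrite ler_nat; apply/subset_leq_card/fintype.subsetP.
  have : \sum_(a < r) (density R G * (M - 1)) <=
         \sum_(a < r) (M - #|part (lift ord0 a)|%:R).
    by apply: ler_sum => a _; apply: deg_lift.
  rewrite sumrB !sumr_const card_ord.
  have : M = #|part ord0|%:R + \sum_(a < r) #|part (lift ord0 a)|%:R.
    by rewrite /M sum_part big_ord_recl natrD natr_sum.
  move=> ME; rewrite -[X in X <= _]mulr_natl -[X in _ <= X - _]mulr_natl densG => Hs.
  rewrite -(ler_nat R) natrM natrD -/M.
  have r1 : 0 < r.+1%:R :> R by rewrite ltr0n.
  have /(ler_wpM2r (ltW r1)) : r%:R * (r%:R / r.+1%:R * (M - 1)) <=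
      r%:R * M - (M - #|K|%:R).
    apply: le_trans (_ : r%:R * ((r%:R / r.+1%:R + delta) * (M - 1)) <= _).
      by apply: ler_wpM2l => //; apply: ler_wpM2r; rewrite ?subr_ge0 ?lerDl.
    by apply: le_trans Hs _; rewrite lerD2l lerN2 lerBlDr {1}ME addrC lerD2l.
  have -> : r%:R * (r%:R / r.+1%:R * (M - 1)) * r.+1%:R = r%:R * r%:R * (M - 1).
    by field; rewrite ?natr1 ?nat1r pnatr_eq0.
  by rewrite -[r.+1%:R]natr1 => h; have := ler0n R r; have := ler0n R #|K|; nra.
rewrite inE => /andP[xH /eqP x0] xK; left.
have : \sum_(a < r.+1) (density R G * (M - 1)) <=
       \sum_(a < r.+1) (M - #|part a|%:R).
  apply: ler_sum => a _; have [->|/deg_lift//] := eqVneq a ord0.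
  by rewrite -x0; apply: deg => //; rewrite xK orbT.
rewrite sumrB !sumr_const card_ord -natr_sum -sum_part -/M densG.
rewrite -[X in X <= _]mulr_natl -[X in _ <= X - _]mulr_natl.
have -> : r.+1%:R * ((r%:R / r.+1%:R + delta) * (M - 1)) =
    r%:R * (M - 1) + r.+1%:R * delta * (M - 1).
  by field; rewrite ?natr1 ?nat1r pnatr_eq0.
by rewrite -{2}[r.+1%:R]natr1; lra.
Qed.

End MultipartiteBound.

(** * Balanced multipartite graphs with a prescribed number of edges *)

(** The map [j -> j d + a] embeds the numbers below [n %/ d] into the residue class, and
    [i -> i %/ d] is injective on that class. *)
Lemma card_residue (n d a : nat) : (a < d)%N ->
  (n %/ d <= #|[set i : 'I_n | (i %% d)%N == a]%SET| <= (n %/ d).+1)%N.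
Proof.
move=> ad; apply/andP; split.
  have lt_n (j : 'I_(n %/ d)) : (j * d + a < n)%N.
    apply: leq_trans (leq_trunc_div n d).
    by apply: leq_trans (leq_mul (ltn_ord j) (leqnn d)); rewrite mulSn addnC ltn_add2r.
  rewrite -[X in (X <= _)%N]card_ord -(card_imset _ (f := fun j => Ordinal (lt_n j))).
    apply: subset_leq_card; apply/fintype.subsetP => _ /imsetP[j _ ->].
    by rewrite inE /= modnMDl modn_small.
  move=> j1 j2 /(congr1 val) /= /addIn/eqP.
  by rewrite eqn_pmul2r ?(leq_trans _ ad) // => /eqP/val_inj.
rewrite -[X in (_ <= X)%N]card_ord -(card_in_imset (f := fun i : 'I_n => inord (i %/ d) : 'I_(n %/ d).+1)).
  exact: max_card.
move=> i j; rewrite !inE => /eqP ia /eqP ja /(congr1 val) /=.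
rewrite !inordK ?ltnS ?leq_div2r 1?ltnW // => ij.
by apply/val_inj; rewrite /= (divn_eq i d) (divn_eq j d) ij ia ja.
Qed.

Section Multipartite.
Variables (V : finType) (r : nat) (col : V -> 'I_r.+1).

Definition multipartite : {set {set V}} :=
  [set e : {set V} | (#|e| == 2%N) && (#|col @: e| == 2%N)]%SET.

Lemma multipartite_set2 x y : ([set x; y]%SET \in multipartite) = (col x != col y).
Proof.
rewrite inE imsetU1 imset_set1 !cards2 !eqSS !eqb1.
by case: (eqVneq x y) => [->|_] //=; rewrite eqxx.
Qed.

Lemma multipartite_graph (F : {set {set V}}) :
  {in F, forall e : {set V}, #|e| = 2%N} ->
  exists2 G : sgraph V, edges G = multipartite :|: F &
    forall x y, adj G x y -> col x = col y -> [set x; y]%SET \in F.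
Proof.
move=> F2.
have E2 : [forall e in multipartite :|: F, #|e| == 2%N].
  by apply/forall_inP => e; rewrite !inE => /orP[/andP[]//|/F2->].
exists (SGraph E2) => // x y; rewrite /adj /= finset.in_setU multipartite_set2.
by case: eqP.
Qed.

Lemma card_multipartite :
  (#|multipartite| * 2 = \sum_x #|[set y | col y != col x]%SET|)%N.
Proof.
have [|G EG _] := @multipartite_graph finset.set0; first by move=> e; rewrite inE.
rewrite -(finset.setU0 multipartite) -EG -handshake; apply: eq_bigr => x _.
apply: eq_card => y; rewrite !inE /adj EG finset.setU0 multipartite_set2 eq_sym.
by [].
Qed.

End Multipartite.

(** Colouring by residues modulo [r + 1] gives classes within 1 of [n / (r + 1)]. The first real
    inequality ensures that the multipartite graph has at most [N] edges, the second that the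
    missing ones fit among the [C(k, 2)] pairs of [K]. *)
Lemma balanced_graph (R : realType) (n r k N : nat) :
  (k * r.+1 <= n)%N ->
  n%:R * (r%:R * n%:R + r.+1%:R) <= 2 * r.+1%:R * N%:R :> R ->
  2 * r.+1%:R * N%:R <=
    n%:R * (r%:R * n%:R - r.+1%:R) + r.+1%:R * (k%:R * (k%:R - 1)) :> R ->
  exists (G : sgraph 'I_n) (col : 'I_n -> 'I_r.+1) (K : {set 'I_n}),
    [/\ #|edges G| = N, #|K| = k &
      forall x y, adj G x y -> col x = col y -> x \in K /\ col x = ord0].
Proof.
move=> kn lo hi.
pose col (i : 'I_n) : 'I_r.+1 := inord (i %% r.+1).
have colE (i : 'I_n) : col i = (i %% r.+1)%N :> nat by rewrite inordK // ltn_pmod.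
have card_class (a : 'I_r.+1) :
    (n %/ r.+1 <= #|[set y | col y == a]%SET| <= (n %/ r.+1).+1)%N.
  rewrite (_ : [set y | _]%SET = [set y : 'I_n | (y %% r.+1)%N == a]%SET).
    exact: card_residue.
  by apply/setP => y; rewrite !inE -colE.
have [K Kcol cK] : exists2 K : {set 'I_n}, K \subset [set y | col y == ord0]%SET & #|K| = k.
  apply: exists_subset_card; have /andP[h _] := card_class ord0.
  by apply: leq_trans h; rewrite leq_divRL.
pose T := multipartite col.
pose EK := [set e : {set 'I_n} | e \subset K & #|e| == 2%N]%SET.
have cEK : #|EK| = 'C(k, 2) by rewrite cards_draws cK.
have cl_lo a : n%:R - r.+1%:R <= r.+1%:R * #|[set y | col y == a]%SET|%:R :> R.
  rewrite lerBlDr -natrM -natrD ler_nat; have /andP[h _] := card_class a.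
  apply: leq_trans (ltnW (ltn_ceil n (ltn0Sn r))) _.
  by rewrite mulSn addnC leq_add2r mulnC leq_mul2l h orbT.
have cl_hi a : r.+1%:R * #|[set y | col y == a]%SET|%:R <= n%:R + r.+1%:R :> R.
  rewrite -natrM -natrD ler_nat; have /andP[_ h] := card_class a.
  apply: leq_trans (leq_mul (leqnn _) h) _.
  by rewrite mulnS addnC leq_add2r mulnC leq_trunc_div.
have cT : 2 * r.+1%:R * #|T|%:R =
    \sum_(x < n) (r.+1%:R * n%:R - r.+1%:R * #|[set y | col y == col x]%SET|%:R) :> R.
  have -> : 2 * r.+1%:R * #|T|%:R = r.+1%:R * (#|T| * 2)%:R :> R.
    by rewrite natrM; ring.
  rewrite card_multipartite natr_sum mulr_sumr.
  apply: eq_bigr => x _; rewrite -mulrBr; congr (_ * _).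
  have <- : ~: [set y | col y == col x]%SET = [set y | col y != col x]%SET.
    by apply/setP => y; rewrite !inE.
  have /(congr1 (fun t => t%:R : R)) := cardsC [set y | col y == col x]%SET.
  by rewrite card_ord natrD => <-; rewrite addrC addKr.
have sumE (a : R) : n%:R * a = \sum_(x < n) a.
  by rewrite sumr_const card_ord mulr_natl.
have cT_le : 2 * r.+1%:R * #|T|%:R <= n%:R * (r%:R * n%:R + r.+1%:R) :> R.
  rewrite cT sumE.
  by apply: ler_sum => x _; have := cl_lo (col x); rewrite -[r.+1%:R]natr1; nra.
have cT_ge : n%:R * (r%:R * n%:R - r.+1%:R) <= 2 * r.+1%:R * #|T|%:R :> R.
  rewrite cT sumE.
  by apply: ler_sum => x _; have := cl_hi (col x); rewrite -[r.+1%:R]natr1; nra.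
have r1 : 0 < 2 * r.+1%:R :> R by rewrite mulr_gt0 // ltr0n.
have TN : (#|T| <= N)%N by rewrite -(ler_nat R) -(ler_pM2l r1) (le_trans cT_le).
have NT : (N - #|T| <= #|EK|)%N.
  rewrite leq_subLR -(ler_nat R) -(ler_pM2l r1) natrD cEK mulrDr.
  by have := bin2_natr R k; nra.
have [F FEK cF] := exists_subset_card NT.
have F2 : {in F, forall e : {set 'I_n}, #|e| = 2%N}.
  by move=> e /(fintype.subsetP FEK); rewrite inE => /andP[_ /eqP].
have [G EG adjG] := multipartite_graph col F2.
have FK x y : [set x; y]%SET \in F -> (x \in K) && (y \in K).
  move=> /(fintype.subsetP FEK); rewrite inE => /andP[/fintype.subsetP sK _].
  by rewrite !sK // !inE eqxx ?orbT.
have in0 x : x \in K -> col x = ord0.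
  by move=> /(fintype.subsetP Kcol); rewrite inE => /eqP.
exists G, col, K; split => // [|x y xy cxy].
  rewrite EG cardsU [X in (_ - X)%N](_ : _ = 0)%N ?subn0 ?cF ?subnKC //.
  apply/eqP; rewrite cards_eq0; apply/eqP/setP => e; rewrite !inE.
  apply/negbTE/negP => /andP[/andP[_ ce]] /(fintype.subsetP FEK).
  rewrite inE => /andP[/fintype.subsetP eK /cards2P[x [y [_ exy]]]].
  move: ce; rewrite exy imsetU1 imset_set1 !in0 ?cards2 ?eqxx //.
    by apply: eK; rewrite exy !inE eqxx orbT.
  by apply: eK; rewrite exy !inE eqxx.
by have /andP[xK _] := FK x y (adjG x y xy cxy); split=> //; apply: in0.
Qed.

(** * Choice of parameters and the final bounds; [y] is the cube root of [n] *)

Lemma f_np_upper (R : realType) (c y : R) (r n : nat) :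
  1 <= c -> (0 < r)%N -> y ^+ 3 = n%:R -> r.+1%:R * (2 * c + 2) <= y ->
  let p : R := r%:R / r.+1%:R + c / y ^+ 2 in
  p * 'C(n, 2)%:R \is a Num.nat ->
  (f_np n p)%:R <= r.+1%:R * (2 * c + 2 + r%:R) * y ^+ 2.
Proof.
move=> c1 r0 yn Ly p /natrP[N pN].
have r1 : 1 <= r%:R :> R by rewrite ler1n.
have d2 : 2 <= r.+1%:R :> R by rewrite ler_nat.
have y8 : 8 <= y by nra.
have x1 : 1 <= y ^+ 2 by rewrite exprn_ege1 //; lra.
have x0 : 0 < y ^+ 2 by lra.
have n0 : (1 < n)%N.
  by rewrite -(ltr_nat R) -yn; apply: (@lt_le_trans _ _ y); [lra | rewrite exprS ler_peMr //; lra].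
(* The added 2 makes [k - 1] exceed [2 c y^2], so [k (k - 1) >= 4 c^2 y^4] covers the surplus edges
   and the rounding of class sizes. *)
pose k := (Num.truncn (2 * c * y ^+ 2)).+2.
have cx0 : 0 <= 2 * c * y ^+ 2 by rewrite mulr_ge0 //; lra.
have /andP[k_hi k_lo] : k%:R - 2 <= 2 * c * y ^+ 2 < k%:R - 1.
  have -> : k%:R = (Num.truncn (2 * c * y ^+ 2))%:R + 2 :> R by rewrite -natrD addn2.
  by have := truncn_itv cx0; rewrite -natr1; lra.
have dN : 2 * r.+1%:R * N%:R =
    r%:R * (y ^+ 3 * (y ^+ 3 - 1)) + r.+1%:R * c * (y * (y ^+ 3 - 1)) :> R.
  have y0 : y != 0 by rewrite gt_eqF //; lra.
  have d0 : r.+1%:R != 0 :> R by rewrite pnatr_eq0.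
  transitivity (r.+1%:R * p * (n%:R * (n%:R - 1))).
    by rewrite -bin2_natr -pN; ring.
  have -> : r.+1%:R * p = r%:R + r.+1%:R * c / y ^+ 2.
    by rewrite /p mulrDr; congr (_ + _); [rewrite mulrC divfK | rewrite mulrA].
  by rewrite -yn; field.
have y34 : 8 * y ^+ 3 <= y ^+ 4 by rewrite [y ^+ 4]exprS ler_wpM2r // exprn_ge0 //; lra.
have y23 : 8 * y ^+ 2 <= y ^+ 3 by rewrite [y ^+ 3]exprS ler_wpM2r // exprn_ge0 //; lra.
have y12 : 8 * y <= y ^+ 2 by rewrite expr2 ler_wpM2r //; lra.
have y3 : 0 <= y ^+ 3 by rewrite exprn_ge0 //; lra.
have dy3 : y ^+ 3 <= r.+1%:R * y ^+ 3 by rewrite ler_peMl //; lra.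
have y4 : y * (y ^+ 3 - 1) = y ^+ 4 - y by ring.
have dr : r%:R = r.+1%:R - 1 :> R by rewrite -natr1 addrK.
have kn : (k * r.+1 <= n)%N.
  rewrite -(ler_nat R) natrM -yn [y ^+ 3]exprS.
  apply: le_trans (_ : r.+1%:R * (2 * c + 2) * y ^+ 2 <= _).
    by rewrite mulrC -mulrA ler_wpM2l //; nra.
  by rewrite ler_wpM2r // ltW.
(* The surplus, of order [y^4], outweighs the terms linear in [n = y^3] that come from rounding and
   from [n (n - 1)] versus [n^2]. *)
have cd : r.+1%:R * y ^+ 3 * 2 <= r.+1%:R * c * (y * (y ^+ 3 - 1)).
  rewrite -!mulrA ler_wpM2l // y4.
  apply: le_trans (_ : y ^+ 4 - y <= _); first lra.
  by rewrite ler_peMl //; lra.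
have kk : c * (y * (y ^+ 3 - 1)) + y ^+ 3 <= k%:R * (k%:R - 1) :> R.
  apply: le_trans (_ : (2 * c * y ^+ 2) ^+ 2 <= _).
    have -> : (2 * c * y ^+ 2) ^+ 2 = 2 * c * (2 * c * y ^+ 4) by ring.
    apply: le_trans (_ : 2 * (c * y ^+ 4) <= _); last first.
      by rewrite -[2 * c * y ^+ 4]mulrA ler_peMl //; nra.
    by rewrite y4; nra.
  by rewrite expr2; apply: ler_pM => //; lra.
have /(ler_wpM2l (ler0n R r.+1)) dkk := kk.
have [||G [col [K [EG cK colG]]]] := @balanced_graph R n r k N kn.
- by rewrite dN -yn dr; lra.
- by rewrite dN -yn dr; lra.
have dG : density R G = p.
  by rewrite /density EG -pN card_ord mulfK // pnatr_eq0 -lt0n bin_gt0.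
apply: (@le_trans _ _ (max_full R G)%:R).
  by rewrite ler_nat; apply: f_np_le; rewrite EG pN.
have [|H fH <-] := max_full_attained R G; first by rewrite card_ord ltnW.
have delta0 : 0 <= c / y ^+ 2 by rewrite divr_ge0 //; lra.
have [h|h] := multipartite_full colG dG delta0 fH.
  have : #|H.1|%:R - 1 <= y ^+ 2.
    (* As [c >= 1], a larger [H] would make the left side of [h] at least [r + 1]. *)
    rewrite leNgt; apply/negP => h1.
    suff : r.+1%:R <= r.+1%:R * (c / y ^+ 2) * (#|H.1|%:R - 1) by rewrite dr in h *; lra.
    rewrite -mulrA ler_peMr // mulrAC.
    rewrite ler_pdivlMr // mul1r; apply: le_trans (ltW h1) _.
    by rewrite ler_peMl //; lra.
  have : 2 * y ^+ 2 <= r.+1%:R * (2 * c + 2 + r%:R) * y ^+ 2.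
    by rewrite ler_wpM2r //; [lra | apply: le_trans d2 _; rewrite ler_peMr //; lra].
  lra.
move: h; rewrite -(ler_nat R) natrM natrD cK => /le_trans; apply.
by rewrite -mulrA ler_wpM2l //; nra.
Qed.

Theorem theorem1 (R : realType) :
  (forall (n : nat) (p : R),
     (2 <= n)%N ->
     p * 'C(n, 2)%:R \is a Num.nat ->
     n%:R `^ (- (2 / 3)) < p < 1 - n%:R `^ (- (1 / 7)) ->
     (f_np n p)%:R >= 1 / 4 * (1 - p) `^ (2 / 3) * n%:R `^ (2 / 3) - 1)
  /\
  (forall (c : R) (r : nat),
     1 <= c -> (0 < r)%N ->
     exists (C1 C2 : R) (n0 : nat),
       [/\ 0 < C1, 0 < C2 &
         forall n : nat, (n0 <= n)%N ->
           let p : R := r%:R / r.+1%:R + c * n%:R `^ (- (2 / 3)) in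
           p * 'C(n, 2)%:R \is a Num.int ->
           C1 * n%:R `^ (2 / 3) <= (f_np n p)%:R <= C2 * n%:R `^ (2 / 3)]).
Proof.
split=> [n p n2 pC /andP[np p1]|c r c1 r0].
  by apply: f_np_lower => //; rewrite np (lt_le_trans p1) // gerBl powR_ge0.
have r1 : 1 <= r%:R :> R by rewrite ler1n.
have d2 : 2 <= r.+1%:R :> R by rewrite ler_nat.
have d0 : 0 < r.+1%:R :> R by lra.
have dr : r%:R / r.+1%:R = 1 - r.+1%:R^-1 :> R.
  by rewrite -[r%:R](addrK 1) natr1 mulrBl divff ?gt_eqF // div1r.
(* For [n > L^3] one has [y >= L], whence [1 - p >= 1 / (2 (r + 1))]. The lower bound is then at
   least [y^2 / (8 (r + 1)) - 1], and half of the main term absorbs the 1, which gives [C1]. *)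
pose L : R := 16 * r.+1%:R * (c + 1).
exists (16 * r.+1%:R)^-1, (r.+1%:R * (2 * c + 2 + r%:R)),
  (Num.truncn (L ^+ 3)).+1; split.
- by rewrite invr_gt0; lra.
- by rewrite mulr_gt0 //; lra.
move=> n n0 p pI.
have [y [y0 yn yE]] :
    exists y : R, [/\ 0 <= y, y ^+ 3 = n%:R & n%:R `^ (2 / 3) = y ^+ 2].
  exists (n%:R `^ (1 / 3)); split; [exact: powR_ge0|exact: (powR_3rd 1)|].
  by rewrite -powR_mulrn ?powR_ge0 // -powRrM; congr (_ `^ _); field.
have Ly : L <= y.
  rewrite -(ler_pXn2r (ltn0Sn 2)) ?nnegrE // ?yn; last by rewrite /L !mulr_ge0 //; lra.
  by apply: ltW; rewrite (lt_le_trans (truncnS_gt _)) // ler_nat.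
have yE' : n%:R `^ (- (2 / 3)) = (y ^+ 2)^-1 by rewrite powRN yE.
have L16 : 16 * r.+1%:R * c + 16 * r.+1%:R <= y by apply: le_trans Ly; rewrite /L; lra.
have dc0 : 2 <= r.+1%:R * c by nra.
have x16 : 16 * r.+1%:R * c + 16 * r.+1%:R <= y ^+ 2.
  by apply: (le_trans L16); rewrite expr2 ler_peMl //; lra.
have x0 : 0 < y ^+ 2 by lra.
have pE : p = 1 - r.+1%:R^-1 + c / y ^+ 2 by rewrite /p yE' dr.
have qlo : (2 * r.+1%:R)^-1 <= 1 - p.
  have : c / y ^+ 2 <= (2 * r.+1%:R)^-1.
    by rewrite ler_pdivrMr // mulrC ler_pdivlMr ?mulr_gt0 //; lra.
  have : r.+1%:R^-1 = 2 * (2 * r.+1%:R)^-1 :> R by rewrite invfM mulrA divff ?mul1r // pnatr_eq0.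
  by move=> dd; rewrite pE dd; move: (_^-1) (c / _) => a b; lra.
have p0 : 0 <= p by rewrite /p addr_ge0 ?mulr_ge0 ?invr_ge0 ?powR_ge0 //; lra.
have q0 : 0 < (2 * r.+1%:R)^-1 :> R by rewrite invr_gt0; lra.
have pN : p * 'C(n, 2)%:R \is a Num.nat by rewrite natrEint pI mulr_ge0.
rewrite yE; apply/andP; split; last first.
  have -> : p = r%:R / r.+1%:R + c / y ^+ 2 by rewrite /p yE'.
  apply: f_np_upper => //; first by apply: (le_trans _ L16); nra.
  by move: pN; rewrite /p yE'.
have n2 : (2 <= n)%N.
  rewrite -(ltr_nat R) -yn exprSr; apply: (@lt_le_trans _ _ (y ^+ 2)); first by lra.
  by rewrite ler_peMr //; lra.
have np : n%:R `^ (- (2 / 3)) < p < 1.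
  apply/andP; split; last by rewrite -subr_gt0 (lt_le_trans q0).
  rewrite yE'; apply: (@le_lt_trans _ _ (c / y ^+ 2)); first by rewrite ler_peMl // invr_ge0 ltW.
  by rewrite /p yE' ltrDr divr_gt0 //; lra.
apply: le_trans (f_np_lower n2 pN np); rewrite yE.
have q23 : (2 * r.+1%:R)^-1 <= (1 - p) `^ (2 / 3).
  by apply: le_trans qlo _; apply: ger1_powR; lra.
have : (2 * r.+1%:R)^-1 * y ^+ 2 <= (1 - p) `^ (2 / 3) * y ^+ 2 by rewrite ler_wpM2r // ltW.
have : 1 <= (16 * r.+1%:R)^-1 * y ^+ 2 by rewrite mulrC ler_pdivlMr ?mulr_gt0 // mul1r; lra.
have -> : (2 * r.+1%:R)^-1 = 8 * (16 * r.+1%:R)^-1 :> R.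
  by field; rewrite ?natr1 ?nat1r pnatr_eq0.
by move: (16 * r.+1%:R)^-1 (_ `^ _) => a b; lra.
Qed.
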